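(* Let $q'$ be a prime power and $q=(q')^{4}$. Then the projective plane $PG(2,q)$ contains a $1$-saturating set of size $2\sqrt{q}+2\sqrt[4]{q}+2$.
   Context: A point set $S\subseteq PG(2,q)$ is $1$-saturating if every point of $PG(2,q)$ lies on a line spanned by two points of $S$ (or belongs to $S$), and $1$ is the smallest value with this property, i.e. $S$ does not already have the property that every point of the plane is a point of $S$ (in general, $\varrho$-saturating means every point lies in a subspace generated by $\varrho+1$ points of $S$, with $\varrho$ minimal). *)

(* Defs.v *)
From HB Require Import structures.
From mathcomp Require Import all_boot all_order all_algebra.
From mathcomp Require Import finmap.

Set Implicit Arguments.
Unset Strict Implicit.
Unset Printing Implicit Defensive.

(* The points of PG(N, F) are the one-dimensional subspaces of F^(N+1). *)
Record pg_point (N : nat) (F : fieldType) : Type := PgPoint {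
  pg_space : {vspace 'rV[F]_N.+1};
  pg_space_dim : \dim pg_space == 1%N
}.

HB.instance Definition _ (N : nat) (F : fieldType) :=
  [isSub for @pg_space N F].
HB.instance Definition _ (N : nat) (F : fieldType) :=
  [Choice of pg_point N F by <:].

(* Every point lies in a subspace generated by rho + 1 points of S. The
   generating points need not be distinct, so that points of S are covered:
   for rho = 1, every point is in S or on a line through two points of S. *)
Definition pg_covered (N : nat) (F : fieldType) (rho : nat)
    (S : {fset pg_point N F}) : Prop :=
  forall P : pg_point N F,
    exists2 T : rho.+1.-tuple (pg_point N F),
      {subset T <= S} & (pg_space P <= \sum_(Q <- T) pg_space Q)%VS.

Definition saturating (N : nat) (F : fieldType) (rho : nat)
    (S : {fset pg_point N F}) : Prop :=
  pg_covered rho S /\ forall r : nat, (r < rho)%N -> ~ pg_covered r S.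

(* Main.v *)
Require Import Defs.
From mathcomp Require Import all_boot all_order all_algebra.
From mathcomp Require Import finmap.
From mathcomp Require Import all_field ring.

(* Let E and K be the subfields of F with q'^2 and q' elements. For v in F^3 the
   map u |-> u . v from E^3 to F is not injective (q'^6 > q'^4), so every point
   lies on an E-rational line. In the same way an E-rational line meets
   B = PG(2, K) and its image B M under any matrix M over E, because
   q'^3 > q'^2. If B and B M are disjoint, every point is thus on a line through
   two points of S = B u B M. To make them disjoint take M = C + w, where w is in
   E \ K and C is the companion matrix of a cubic X^3 - X - c over K without roots
   in K: a common point would give C an eigenvalue in K. *)

Set Implicit Arguments.
Unset Strict Implicit.
Unset Printing Implicit Defensive.

Import GRing.Theory.

(** * Subfields as fixed points of powers of Frobenius *)

Section FrobeniusFixed.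
Local Open Scope ring_scope.

Variables (F : finFieldType) (p : nat).
Hypothesis pcharFp : p \in [pchar F].

(** When [#|F|] is a power of [d], this is the subfield with [d] elements, kept as a subset of [F]
    so that all coordinates live in one field. *)
Definition frob_fixed (d : nat) : {set F} := [set x | x ^+ d == x].

Lemma frob_fixedP d x : reflect (x ^+ d = x) (x \in frob_fixed d).
Proof. by rewrite inE; apply: eqP. Qed.

Lemma frob_fixed0 d : (0 < d)%N -> 0 \in frob_fixed d.
Proof. by move=> d_gt0; apply/frob_fixedP; rewrite expr0n gtn_eqF. Qed.

Lemma frob_fixed1 d : 1 \in frob_fixed d.
Proof. by apply/frob_fixedP; rewrite expr1n. Qed.

Lemma frob_fixedM d x y :
  x \in frob_fixed d -> y \in frob_fixed d -> x * y \in frob_fixed d.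
Proof.
by move=> /frob_fixedP xd /frob_fixedP yd; apply/frob_fixedP; rewrite exprMn xd yd.
Qed.

Lemma frob_fixedV d x : x \in frob_fixed d -> x^-1 \in frob_fixed d.
Proof. by move=> /frob_fixedP xd; apply/frob_fixedP; rewrite exprVn xd. Qed.

Lemma frob_fixed_expn d x m :
  x \in frob_fixed d -> x \in frob_fixed (d ^ m).
Proof.
move=> /frob_fixedP xd; apply/frob_fixedP.
by elim: m => [|m IHm]; rewrite ?expr1 // expnS exprM xd.
Qed.

Lemma exprD_pchar d (x y : F) : p.-nat d -> (x + y) ^+ d = x ^+ d + y ^+ d.
Proof.
by move=> pd; rewrite exprDn_pchar // (eq_pnat _ (pcharf_eq pcharFp)).
Qed.

Lemma exprB_pchar d (x y : F) : p.-nat d -> (x - y) ^+ d = x ^+ d - y ^+ d.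
Proof. by move=> pd; apply/eqP; rewrite eq_sym subr_eq -exprD_pchar // subrK. Qed.

Lemma frob_fixedB d x y : p.-nat d ->
  x \in frob_fixed d -> y \in frob_fixed d -> x - y \in frob_fixed d.
Proof.
move=> pd /frob_fixedP xd /frob_fixedP yd.
by apply/frob_fixedP; rewrite exprB_pchar // xd yd.
Qed.

Lemma frob_fixedD d x y : p.-nat d ->
  x \in frob_fixed d -> y \in frob_fixed d -> x + y \in frob_fixed d.
Proof.
move=> pd /frob_fixedP xd /frob_fixedP yd.
by apply/frob_fixedP; rewrite exprD_pchar // xd yd.
Qed.

(** Raising to the power [d] is additive, so the polynomial for [m.+1] is the [d]-th power of the
    one for [m], plus ['X^d - 'X]; induct on [m]. *)
Lemma dvdp_XnsubX d m : p.-nat d -> ('X^d - 'X : {poly F}) %| 'X^(d ^ m) - 'X.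
Proof.
move=> pd; have chd : [pchar {poly F}].-nat d.
  by rewrite (eq_pnat _ (pchar_poly F)) (eq_pnat _ (pcharf_eq pcharFp)).
have d_gt0 : (0 < d)%N by case/andP: pd.
elim: m => [|m IHm]; first by rewrite expr1 subrr dvdp0.
have -> : 'X^(d ^ m.+1) - 'X = ('X^(d ^ m) - 'X) ^+ d + ('X^d - 'X) :> {poly F}.
  have -> : ('X^(d ^ m) - 'X) ^+ d = 'X^(d ^ m.+1) - 'X^d :> {poly F}.
    apply/eqP; rewrite eq_sym subr_eq -exprDn_pchar // subrK.
    by rewrite expnSr exprM.
  by rewrite addrA subrK.
rewrite dvdp_add //; apply: dvdp_trans IHm _.
by rewrite -(prednK d_gt0) exprS dvdp_mulr.
Qed.

(** ['X^#|F| - 'X] is the product of all ['X - x%:P], so its divisor ['X^d - 'X] splits over [F]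
    into distinct linear factors and has exactly [d] roots. *)
Lemma card_frob_fixed d m :
  p.-nat d -> (1 < d)%N -> #|F| = (d ^ m)%N -> #|frob_fixed d| = d.
Proof.
move=> pd d_gt1 cardFd.
have szd : size ('X^d - 'X : {poly F}) = d.+1.
  by rewrite size_polyDl ?size_polyXn // size_polyN size_polyX.
have := dvdp_XnsubX m pd; rewrite -cardFd finField_genPoly.
rewrite -big_filter => /dvdp_prod_XsubC[msk].
set s := mask _ _ => eq_s.
have s_uniq : uniq s by rewrite mask_uniq // filter_uniq // index_enum_uniq.
have: size (\prod_(x <- s) ('X - x%:P)) = d.+1 by rewrite -szd (eqp_size eq_s).
rewrite size_prod_XsubC => -[szs]; rewrite -[RHS]szs -(card_uniqP s_uniq).
apply: eq_card => x; rewrite !inE -root_prod_XsubC -(eqp_root eq_s).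
by rewrite rootE !hornerE subr_eq0.
Qed.

End FrobeniusFixed.

(** * Zeros of a linear form by counting *)

Section LinearForms.
Local Open Scope ring_scope.

Variable F : finFieldType.

Lemma pigeonhole_in (aT rT : finType) (A : {pred aT}) (B : {pred rT})
    (f : aT -> rT) :
  (forall x, x \in A -> f x \in B) -> (#|B| < #|A|)%N ->
  exists x y, [/\ x \in A, y \in A, f x = f y & x != y].
Proof.
move=> fAB ltBA.
have /dinjectivePn[x xA [y /andP[neq yA] eqf]] : ~~ dinjectiveb f A.
  apply/negP => /dinjectiveP/card_in_image cardfA.
  move: ltBA; rewrite -cardfA ltnNge subset_leq_card //.
  by apply/subsetP => _ /imageP[x xA ->]; apply: fAB.
by exists x, y; split=> //; rewrite eq_sym.
Qed.

(** Two distinct vectors over [D] have the same value, and their difference is the solution. It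
    serves both for lines through a given point and for subplane points on a given line. *)
Lemma small_solution n (D T : {set F}) (w : 'cV[F]_n) :
    (forall x y, x \in D -> y \in D -> x - y \in D) ->
    (forall x : 'rV_n, (forall j, x 0 j \in D) -> (x *m w) 0 0 \in T) ->
    (#|T| < #|D| ^ n)%N ->
  exists x : 'rV_n, [/\ x != 0, forall j, x 0 j \in D & x *m w = 0].
Proof.
move=> DB DT ltTD; pose row (g : {ffun 'I_n -> F}) := \row_j g j.
have [||g [h [gD hD eqgh neqgh]]] :=
    @pigeonhole_in _ _ (ffun_on (mem D)) T (fun g => (row g *m w) 0 0).
- by move=> g /ffun_onP gD; apply: DT => j; rewrite mxE; apply: gD.
- by rewrite card_ffun_on card_ord.
exists (row g - row h); split.
- apply: contraNneq neqgh => /eqP; rewrite subr_eq0 => /eqP/rowP eq_row.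
  by apply/eqP/ffunP => j; have := eq_row j; rewrite !mxE.
- by move=> j; rewrite !mxE; apply: DB; [apply: (ffun_onP gD) | apply: (ffun_onP hD)].
- apply/rowP => j; rewrite (ord1 j) mulmxBl !mxE -[X in X - _]/(_) .
  by apply/eqP; rewrite subr_eq0; move/eqP: eqgh; rewrite !mxE.
Qed.

End LinearForms.

(** * Coordinates, the companion matrix, lines and points of the plane *)

Section Plane.
Local Open Scope ring_scope.

Variable F : fieldType.
Implicit Types (x y v : 'rV[F]_3) (a b c : F).

Lemma forall_ord3 (P : 'I_3 -> Prop) : P 0 -> P 1 -> P 2 -> forall j, P j.
Proof.
move=> P0 P1 P2 [[|[|[|//]]] lt_j3].
- by rewrite (_ : Ordinal _ = 0) //; apply: val_inj.
- by rewrite (_ : Ordinal _ = 1) //; apply: val_inj.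
- by rewrite (_ : Ordinal _ = 2) //; apply: val_inj.
Qed.

Definition row3 a b c : 'rV[F]_3 := \row_j [:: a; b; c]`_j.

Lemma row3E a b c :
  (row3 a b c 0 0 = a) * (row3 a b c 0 1 = b) * (row3 a b c 0 2 = c).
Proof. by rewrite !mxE. Qed.

Lemma row3P x y :
  x 0 0 = y 0 0 -> x 0 1 = y 0 1 -> x 0 2 = y 0 2 -> x = y.
Proof. by move=> *; apply/rowP; apply: forall_ord3. Qed.

(** Companion matrix of X^3 - X - c, for the action on row vectors. *)
Definition cubic_mx c : 'M[F]_3 :=
  \matrix_(i, j) nth 0 (nth [::] [:: [:: 0; 1; 0]; [:: 0; 0; 1]; [:: c; 1; 0]] i) j.

Lemma mul_cubic_mx c x :
  x *m cubic_mx c = row3 (c * x 0 2) (x 0 0 + x 0 2) (x 0 1).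
Proof.
have sum3 (G : 'I_3 -> F) : \sum_j G j = G 0 + (G 1 + G 2).
  rewrite !big_ord_recl big_ord0 addr0.
  by congr (G _ + (G _ + G _)); apply: val_inj.
by apply: row3P; rewrite row3E mxE sum3 !mxE /=; ring.
Qed.

(** The last two coordinates of the equation give x1 = a x2 and x0 = (a^2 - 1) x2, so x2 is nonzero;
    the first one, c x2 = a x0, is then divided by x2. *)
Lemma cubic_mx_eigen c a x :
  x *m cubic_mx c = a *: x -> x != 0 -> a ^+ 3 - a = c.
Proof.
rewrite mul_cubic_mx => /rowP eq_x.
have := eq_x 0; have := eq_x 1; have := eq_x 2; rewrite !row3E !mxE => e2 e1 e0 x_neq0.
have [x2_eq0 | x2_neq0] := eqVneq (x 0 2) 0.
  case/eqP: x_neq0; apply: row3P; rewrite mxE //.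
    by move: e1; rewrite e2 x2_eq0 mulr0 addr0 mulr0.
  by rewrite e2 x2_eq0 mulr0.
apply: (mulIf x2_neq0); rewrite e0; move: e1; rewrite e2.
by move/(canRL (addrK _)) => ->; ring.
Qed.

(** First nonzero coordinate, or 0 for the zero vector; scaling it to 1 selects one vector per
    point. *)
Definition lead_coord x :=
  if x 0 0 != 0 then x 0 0 else if x 0 1 != 0 then x 0 1 else x 0 2.

Lemma lead_coordZ a x : lead_coord (a *: x) = a * lead_coord x.
Proof.
rewrite /lead_coord !mxE; have [->|a_neq0] := eqVneq a 0.
  by rewrite !mul0r eqxx.
by rewrite !mulf_eq0 (negPf a_neq0) /=; do 2?case: ifP.
Qed.

Lemma lead_coord_eq0 x : (lead_coord x == 0) = (x == 0).
Proof.
apply/eqP/eqP => [|->]; last by rewrite /lead_coord !mxE eqxx.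
rewrite /lead_coord; case: eqVneq => [x0|/eqP//]; case: eqVneq => [x1 x2|/eqP//].
by apply: row3P; rewrite mxE.
Qed.

Lemma lead_coord_in (D : {pred F}) x :
  (forall j, x 0 j \in D) -> lead_coord x \in D.
Proof. by move=> xD; rewrite /lead_coord; do 2?case: ifP. Qed.

(** The kernel of a nonzero form has dimension at most 2, so the two independent vectors [x] and [y]
    in it already span it. *)
Lemma mem_line_span (w : 'cV[F]_3) x y v :
    w != 0 -> x *m w = 0 -> y *m w = 0 -> v *m w = 0 ->
    x != 0 -> y \notin <[x]>%VS ->
  v \in (<[x]> + <[y]>)%VS.
Proof.
move=> w_neq0 xw yw vw x_neq0 y_notin.
pose f : 'Hom('rV[F]_3, 'M[F]_1) := linfun (mulmxr w).
have kerfP u : u *m w = 0 -> u \in lker f by move=> uw; rewrite memv_ker lfunE /= uw.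
have dim_ker : (\dim (lker f) <= 2)%N.
  have := limg_ker_dim f fullv; rewrite capfv dimvf /dim /= mul1n => dimE.
  have : (0 < \dim (limg f))%N.
    rewrite lt0n dimv_eq0; apply: contraNneq w_neq0 => limg0.
    apply/eqP/row_matrixP => i; rewrite row0 rowE.
    have := memv_img f (memvf (delta_mx 0 i)).
    by rewrite limg0 memv0 lfunE => /eqP.
  by move=> limg_gt0; rewrite -(leq_add2r (\dim (limg f))) dimE (leq_add2l 2 1).
have sub_ker : (<[x]> + <[y]> <= lker f)%VS.
  by apply/subvP => _ /memv_addP[_ /vlineP[a ->] [_ /vlineP[b ->] ->]];
     rewrite rpredD // rpredZ // kerfP.
have dim_sum : (1 < \dim (<[x]> + <[y]>))%N.
  rewrite ltnNge; apply: contra y_notin => dim_le1.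
  have /eqP -> : (<[x]> == <[x]> + <[y]>)%VS.
    by rewrite eqEdim addvSl dim_vline x_neq0.
  by rewrite memvE addvSr.
have /eqP -> : (<[x]> + <[y]> == lker f)%VS.
  by rewrite eqEdim sub_ker (leq_trans dim_ker dim_sum).
exact: kerfP.
Qed.

Lemma dim_line_delta : \dim <[delta_mx 0 0 : 'rV[F]_3]> == 1%N.
Proof.
suff d_neq0 : delta_mx 0 0 != 0 :> 'rV[F]_3 by rewrite dim_vline d_neq0.
by apply/eqP => /matrixP/(_ 0 0)/eqP; rewrite !mxE oner_eq0.
Qed.

(* For [v = 0] this is the junk value [<[delta_mx 0 0]>]. *)
Definition proj_point v : pg_point 2 F :=
  insubd (PgPoint dim_line_delta) <[v]>%VS.

Lemma proj_pointE v : v != 0 -> pg_space (proj_point v) = <[v]>%VS.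
Proof. by move=> v_neq0; apply: insubdK; rewrite -topredE /= dim_vline v_neq0. Qed.

Lemma pg_pointP (P : pg_point 2 F) : exists2 v, v != 0 & pg_space P = <[v]>%VS.
Proof.
have dimP := pg_space_dim P; exists (vpick (pg_space P)).
  by rewrite vpick0 -dimv_eq0 (eqP dimP).
apply/eqP; rewrite eq_sym eqEdim -memvE memv_pick (eqP dimP) dim_vline.
by rewrite vpick0 -dimv_eq0 (eqP dimP).
Qed.

End Plane.

(** * One vector for each point of a subplane *)

Section NormalizedVectors.
Local Open Scope ring_scope.

Variables (F : finFieldType) (D : {set F}).

Definition normalized : {set 'rV[F]_3} :=
  [set x | (lead_coord x == 1) && [forall j, x 0 j \in D]].

Lemma normalizedP (x : 'rV[F]_3) :
  reflect (lead_coord x = 1 /\ forall j, x 0 j \in D) (x \in normalized).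
Proof.
rewrite inE; apply: (iffP andP) => [[/eqP ? /forallP ?]|[/eqP ? /forallP ?]] //.
Qed.

Lemma normalized_neq0 x : x \in normalized -> x != 0.
Proof. by case/normalizedP=> lx _; rewrite -lead_coord_eq0 lx oner_eq0. Qed.

Lemma normalized_scale a x y :
  x \in normalized -> y \in normalized -> x = a *: y -> x = y.
Proof.
case/normalizedP=> lx _ /normalizedP[ly _] eq_x; move: lx.
by rewrite eq_x lead_coordZ ly mulr1 => ->; rewrite scale1r.
Qed.

Lemma card_normalized :
  0 \in D -> 1 \in D -> #|normalized| = (#|D| ^ 2 + #|D| + 1)%N.
Proof.
move=> D0 D1.
(* Split by the position of the leading 1: the vectors (1, a, b), (0, 1, b) and (0, 0, 1). *)
pose A := [set row3 1 u.1 u.2 | u in setX D D].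
pose B := [set row3 0 1 b | b in D].
have -> : normalized = A :|: B :|: [set row3 0 0 1].
  apply/setP => x; apply/normalizedP/idP => [[]|]; last first.
    rewrite !in_setU in_set1 => /orP[/orP[] /imsetP|/eqP ->].
    - case=> -[a b] /setXP[/= aD bD ->]; rewrite /lead_coord !row3E oner_eq0; split=> //.
      by apply: forall_ord3; rewrite row3E.
    - case=> b bD ->; rewrite /lead_coord !row3E eqxx oner_eq0; split=> //.
      by apply: forall_ord3; rewrite row3E.
    - rewrite /lead_coord !row3E eqxx; split=> //.
      by apply: forall_ord3; rewrite row3E.
  rewrite /lead_coord !in_setU in_set1.
  case: eqVneq => [x0|_ x0 xD]; last first.
    apply/orP; left; apply/orP; left; apply/imsetP; exists (x 0 1, x 0 2).
      by rewrite inE !xD.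
    by apply: row3P; rewrite row3E.
  case: eqVneq => [x1 x2 _|_ x1 xD].
    by apply/orP; right; apply/eqP/row3P; rewrite row3E.
  apply/orP; left; apply/orP; right; apply/imsetP; exists (x 0 2) => //.
  by apply: row3P; rewrite row3E.
have inj_A : injective (fun u : F * F => row3 1 u.1 u.2).
  move=> [a b] [a' b'] /= /matrixP/(_ 0) eq_r.
  by have := eq_r 1; have := eq_r 2; rewrite !row3E => -> ->.
have inj_B : injective (fun b : F => row3 0 1 b).
  by move=> b b' /matrixP/(_ 0 2); rewrite !row3E.
rewrite !cardsU cards1 !card_imset // cardsX mulnn.
have -> : A :&: B = set0.
  apply/setP => x; rewrite !inE; apply/andP => -[/imsetP[u _ ->] /imsetP[b _]].
  by move/matrixP/(_ 0 0)/eqP; rewrite !row3E oner_eq0.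
have -> : (A :|: B) :&: [set row3 0 0 1] = set0.
  apply/setP => x; rewrite !inE; apply/andP => -[/[swap] /eqP ->].
  case/orP=> /imsetP[u _ /matrixP/(_ 0) eq_r].
    by have /eqP := eq_r 0; rewrite !row3E eq_sym oner_eq0.
  by have /eqP := eq_r 1; rewrite !row3E eq_sym oner_eq0.
by rewrite !cards0 !subn0.
Qed.

End NormalizedVectors.

(** * A cubic without roots in the small subfield *)

Section Cubic.
Local Open Scope ring_scope.

Variables (F : finFieldType) (d : nat).

Local Notation K := (frob_fixed F d).

(* [x ^+ 3 - x] takes the value 0 at both 0 and 1, so it misses some value. *)
Lemma cubic_without_root : (0 < d)%N ->
  exists2 c : F, c \in K & forall a, a \in K -> a ^+ 3 - a != c.
Proof.
move=> d_gt0; have K0 : 0 \in K by apply: frob_fixed0.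
pose f (a : F) := a ^+ 3 - a.
have f01 : f 0 = f 1 by rewrite /f expr0n expr1n !subrr.
have [/forall_inP surj_f|] := boolP [forall c in K, c \in f @: (K :\ 0)].
  have /subset_leq_card : K \subset f @: (K :\ 0) by apply/subsetP.
  move/leq_trans/(_ (leq_imset_card _ _)).
  by rewrite [X in (X <= _)%N](cardsD1 0) K0 ltnn.
rewrite negb_forall => /existsP[c]; rewrite negb_imply => /andP[cK c_notin].
exists c => // a aK; apply: contraNneq c_notin => fa.
(* The value at 0 is also taken at 1, hence lies in the image of [K :\ 0]. *)
apply/imsetP; have [a0|a_neq0] := eqVneq a 0; last first.
  by exists a; rewrite ?fa // in_setD1 a_neq0.
exists 1; first by rewrite in_setD1 oner_eq0 frob_fixed1.
by rewrite -f01 -fa a0.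
Qed.

Variable p : nat.
Hypotheses (pcharFp : p \in [pchar F]) (pd : p.-nat d).

(* If the root [a] is not in [K], its conjugate is another root, and the third
   one, minus their sum, is fixed by Frobenius. *)
Lemma cubic_root_descent (a c : F) :
    c \in K -> a \in frob_fixed F (d ^ 2) -> a ^+ 3 - a = c ->
  exists2 b, b \in K & b ^+ 3 - b = c.
Proof.
move=> /frob_fixedP cK /frob_fixedP aE ac.
have [aK|a_neq] := eqVneq (a ^+ d) a; first by exists a => //; apply/frob_fixedP.
pose a' := a ^+ d.
have a'c : a' ^+ 3 - a' = c.
  by rewrite -[RHS]cK -ac (exprB_pchar pcharFp) // /a' exprAC.
have : (a' - a) * (a' ^+ 2 + a' * a + a ^+ 2 - 1) = 0.
  by transitivity ((a' ^+ 3 - a') - (a ^+ 3 - a)); [ring | rewrite ac a'c subrr].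
move/eqP; rewrite mulf_eq0 subr_eq0 (negPf a_neq) /= => /eqP quad0.
(* Written with differences so that [exprB_pchar] handles the signs. The [d]-th power swaps [a] and
   [a'], because [a] is fixed by the power [d ^ 2]. *)
exists (0 - a - a').
  apply/frob_fixedP; rewrite !(exprB_pchar pcharFp) // expr0n gtn_eqF ?mulr0n; last by case/andP: pd.
  by rewrite -exprM mulnn aE -/a'; ring.
rewrite -ac; apply/eqP; rewrite -subr_eq0; apply/eqP.
(* For b = - a - a' the difference of the cubics at b and a is (b - a)(b^2 + a b + a^2 - 1), and the
   second factor equals the quadratic in [quad0]. *)
transitivity (- (a' + a *+ 2) * (a' ^+ 2 + a' * a + a ^+ 2 - 1)); first by ring.
by rewrite quad0 mulr0.
Qed.

End Cubic.

(** * The two disjoint subplanes and their union *)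

Section BaerPair.
Local Open Scope ring_scope.

Variables (F : finFieldType) (p d : nat).
Hypotheses (pcharFp : p \in [pchar F]) (pd : p.-nat d) (d_gt1 : (1 < d)%N).
Hypothesis cardF : #|F| = (d ^ 4)%N.

Local Notation K := (frob_fixed F d).
Local Notation E := (frob_fixed F (d ^ 2)).

Variables w c : F.
Implicit Types x y : 'rV[F]_3.
Hypotheses (wE : w \in E) (wK : w \notin K).
Hypotheses (cK : c \in K) (c_noroot : forall a, a \in K -> a ^+ 3 - a != c).

Let d_gt0 : (0 < d)%N. Proof. exact: ltnW. Qed.
Let pd2 : p.-nat (d ^ 2)%N. Proof. by rewrite pnatX pd. Qed.

Definition baer_mx : 'M[F]_3 := cubic_mx c + w%:M.

(** One vector per point of B and of B M; those of B M need not be normalized. *)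
Definition baer_pair : {set 'rV[F]_3} :=
  normalized K :|: [set x *m baer_mx | x in normalized K].

Lemma card_K : #|K| = d.
Proof. exact: (card_frob_fixed pcharFp pd d_gt1 cardF). Qed.

Lemma card_E : #|E| = (d ^ 2)%N.
Proof.
have d2_gt1 : (1 < d ^ 2)%N by rewrite -(exp1n 2) ltn_exp2r.
by apply: (card_frob_fixed pcharFp pd2 d2_gt1 (m := 2)); rewrite cardF -expnM.
Qed.

Lemma K_sub_E a : a \in K -> a \in E.
Proof. exact: frob_fixed_expn. Qed.

Lemma mul_baer_mx x : x *m baer_mx = x *m cubic_mx c + w *: x.
Proof. by rewrite mulmxDr mul_mx_scalar. Qed.

(** A nonzero kernel vector would make [- w] an eigenvalue of the companion matrix, hence a root of
    the cubic in E, and a root in E yields one in K. *)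
Lemma mul_baer_mx_eq0 x : x *m baer_mx = 0 -> x = 0.
Proof.
rewrite mul_baer_mx => /eqP; rewrite addr_eq0 -scaleNr => /eqP eig.
apply/eqP/negPn/negP => x_neq0; have := cubic_mx_eigen eig x_neq0.
have NwE : - w \in E.
  by rewrite -sub0r (frob_fixedB pcharFp) // frob_fixed0 ?expn_gt0 ?d_gt0.
case/(cubic_root_descent pcharFp pd cK NwE) => b bK.
by apply/eqP/c_noroot.
Qed.

Lemma mul_cubic_mx_K x :
  (forall j, x 0 j \in K) -> forall j, (x *m cubic_mx c) 0 j \in K.
Proof.
move=> xK; rewrite mul_cubic_mx.
apply: forall_ord3; rewrite row3E //; first exact: frob_fixedM.
exact: (frob_fixedD pcharFp).
Qed.

(* Subtracting from [x C + w x = l y] its Frobenius conjugate to eliminate [y],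
   [x] would be an eigenvector of [C] with an eigenvalue in [K]. *)
Lemma baer_disjoint x y l :
    (forall j, x 0 j \in K) -> (forall j, y 0 j \in K) -> x != 0 ->
  x *m baer_mx <> l *: y.
Proof.
move=> xK yK x_neq0 eq_xy; pose z := x *m cubic_mx c.
have eqz j : z 0 j + w * x 0 j = l * y 0 j.
  by move: eq_xy; rewrite mul_baer_mx => /matrixP/(_ 0 j); rewrite !mxE.
have eqz' j : z 0 j + w ^+ d * x 0 j = l ^+ d * y 0 j.
  have /frob_fixedP zKj := mul_cubic_mx_K xK j.
  have /frob_fixedP xKj := xK j; have /frob_fixedP yKj := yK j.
  by rewrite -[in RHS]yKj -exprMn -eqz (exprD_pchar pcharFp) // exprMn zKj xKj.
have elim_y : (l ^+ d - l) *: z = (l * w ^+ d - l ^+ d * w) *: x.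
  apply/matrixP => i j; rewrite (ord1 i) mxE [RHS]mxE.
  apply/eqP; rewrite -subr_eq0; apply/eqP.
  transitivity (l ^+ d * (z 0 j + w * x 0 j) - l * (z 0 j + w ^+ d * x 0 j)).
    by ring.
  by rewrite eqz eqz'; ring.
(* If [l] is in K, then [l * (w ^+ d - w)] kills [x]: either [l = 0], against the injectivity of
   [baer_mx], or [w] is in K. *)
have [lK|l_neq] := eqVneq (l ^+ d) l.
  move: elim_y; rewrite lK subrr scale0r -mulrBr => /esym/eqP.
  rewrite scaler_eq0 (negPf x_neq0) orbF mulf_eq0 subr_eq0 => /orP[/eqP l0|].
    by move: eq_xy; rewrite l0 scale0r => /mul_baer_mx_eq0/eqP; apply/negP.
  by apply/negP; apply: contra wK => /eqP ?; apply/frob_fixedP.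
pose a := (l ^+ d - l)^-1 * (l * w ^+ d - l ^+ d * w).
have eig : z = a *: x.
  by rewrite -scalerA -elim_y scalerA mulVf ?scale1r // subr_eq0.
suff aK : a \in K by have /eqP := c_noroot aK; apply; apply: cubic_mx_eigen eig x_neq0.
(* The eigenvalue is a quotient of coordinates of [z] and [x], all of which are in K. *)
have /rV0Pn[j xj_neq0] := x_neq0.
have -> : a = z 0 j * (x 0 j)^-1 by rewrite eig mxE mulfK.
by rewrite frob_fixedM ?frob_fixedV // mul_cubic_mx_K.
Qed.

Lemma normalized_K x : x \in normalized K -> forall j, x 0 j \in K.
Proof. by case/normalizedP. Qed.

Lemma baer_pairP x :
  x \in baer_pair ->
  x \in normalized K \/ exists2 y, y \in normalized K & x = y *m baer_mx.
Proof. by rewrite in_setU => /orP[|/imsetP]; [left | right]. Qed.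

Lemma baer_pair_neq0 x : x \in baer_pair -> x != 0.
Proof.
case/baer_pairP => [/normalized_neq0 //|[y yN ->]].
by apply: contraNneq (normalized_neq0 yN) => /mul_baer_mx_eq0/eqP.
Qed.

Lemma mul_baer_mx_scale x y a : x *m baer_mx = a *: (y *m baer_mx) -> x = a *: y.
Proof.
move/eqP; rewrite -subr_eq0 scalemxAl -mulmxBl => /eqP/mul_baer_mx_eq0/eqP.
by rewrite subr_eq0 => /eqP.
Qed.

(** Makes [proj_point] injective on [baer_pair]: normalization settles two vectors of the same
    subplane, disjointness the mixed cases. *)
Lemma baer_pair_scale x y a :
  x \in baer_pair -> y \in baer_pair -> x = a *: y -> x = y.
Proof.
move=> xB yB eq_x; have x_neq0 := baer_pair_neq0 xB.
case/baer_pairP: xB eq_x => [xN|[x' xN ->]];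
  case/baer_pairP: yB => [yN|[y' yN ->]].
- exact: normalized_scale xN yN.
- move=> eq_x; have a_neq0 : a != 0.
    by apply: contraNneq x_neq0 => a0; rewrite eq_x a0 scale0r.
  case: (@baer_disjoint y' x a^-1); try exact: normalized_K.
    exact: normalized_neq0 yN.
  by rewrite eq_x scalerA mulVf ?scale1r.
- by move/baer_disjoint; case; rewrite ?(normalized_neq0 xN) //; apply: normalized_K.
- by move/mul_baer_mx_scale/(normalized_scale xN yN) ->.
Qed.

Lemma card_baer_pair : #|baer_pair| = (2 * d ^ 2 + 2 * d + 2)%N.
Proof.
rewrite cardsU (_ : _ :&: _ = set0); last first.
  apply/setP => x; rewrite in_setI in_set0; apply/andP => -[xN /imsetP[y yN eq_x]].
  case: (@baer_disjoint y x 1); rewrite ?scale1r //; try exact: normalized_K.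
  exact: normalized_neq0 yN.
rewrite cards0 subn0 card_in_imset => [|x y xN yN eq_xy]; last first.
  by rewrite -[y]scale1r; apply: mul_baer_mx_scale; rewrite scale1r.
by rewrite card_normalized ?frob_fixed0 ?frob_fixed1 // card_K; ring.
Qed.

Lemma normalize x :
    x != 0 -> (forall j, x 0 j \in K) ->
  exists2 y, y \in normalized K & exists2 a, a != 0 & y = a *: x.
Proof.
rewrite -lead_coord_eq0 => lx_neq0 xK; pose a := (lead_coord x)^-1.
exists (a *: x); last by exists a => //; rewrite invr_eq0.
apply/normalizedP; rewrite lead_coordZ mulVf //; split=> // j.
by rewrite mxE frob_fixedM // frob_fixedV // lead_coord_in.
Qed.

Lemma form_in_E (x : 'rV[F]_3) (u : 'cV[F]_3) :
  (forall j, x 0 j \in E) -> (forall j, u j 0 \in E) -> (x *m u) 0 0 \in E.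
Proof.
move=> xE uE; rewrite mxE; elim/big_ind: _ => [|a b|j _].
- by rewrite frob_fixed0 // expn_gt0 d_gt0.
- exact: (frob_fixedD pcharFp).
- exact: frob_fixedM.
Qed.

Lemma baer_mx_E i j : baer_mx i j \in E.
Proof.
have [E0 E1] : 0 \in E /\ 1 \in E by rewrite frob_fixed0 ?frob_fixed1 ?expn_gt0 ?d_gt0.
rewrite !mxE; apply: (frob_fixedD pcharFp) => //; last by case: (i == j).
by move: i j; do 2?apply: forall_ord3; rewrite //= K_sub_E.
Qed.

Lemma subplane_meets_line (u : 'cV[F]_3) :
  (forall j, u j 0 \in E) -> exists2 x, x \in normalized K & x *m u = 0.
Proof.
move=> uE; case: (@small_solution F 3 K E u).
- by move=> a b; apply: (frob_fixedB pcharFp).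
- by move=> x xK; apply: form_in_E => // j; apply: K_sub_E.
- by rewrite card_K card_E ltn_exp2l.
move=> x [x_neq0 xK xu]; have [y yN [a _ eq_y]] := normalize x_neq0 xK.
by exists y; rewrite // eq_y -scalemxAl xu scaler0.
Qed.

(** Here the roles are exchanged: [v] is the form and the line [u] the unknown vector, whence the
    transposes. *)
Lemma on_rational_line (v : 'rV[F]_3) :
  exists u : 'cV[F]_3, [/\ u != 0, forall j, u j 0 \in E & v *m u = 0].
Proof.
case: (@small_solution F 3 E [set: F] v^T).
- by move=> a b; apply: (frob_fixedB pcharFp).
- by move=> x _; rewrite inE.
- by rewrite card_E cardsT cardF -expnM ltn_exp2l.
move=> x [x_neq0 xE xv]; exists x^T; split.
- by rewrite trmx_eq0.
- by move=> j; rewrite mxE.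
- by rewrite -[v]trmxK -trmx_mul xv trmx0.
Qed.

Lemma baer_pair_covers (v : 'rV[F]_3) :
  exists x y, [/\ x \in baer_pair, y \in baer_pair & v \in (<[x]> + <[y]>)%VS].
Proof.
have [u [u_neq0 uE vu]] := on_rational_line v.
have [x xN xu] := subplane_meets_line uE.
(* The point [y *m baer_mx] is on the line [u] when [y] is on [baer_mx *m u], which is again
   rational over E. *)
have [|y yN yu] := @subplane_meets_line (baer_mx *m u).
  move=> j; have := @form_in_E (row j baer_mx) u; rewrite -row_mul mxE; apply=> // i.
  by rewrite mxE baer_mx_E.
exists x, (y *m baer_mx); split; first by rewrite in_setU xN.
  by rewrite in_setU; apply/orP; right; apply/imsetP; exists y.
apply: (mem_line_span u_neq0) => //; rewrite -?mulmxA //.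
  exact: normalized_neq0 xN.
apply/negP => /vlineP[a]; apply: baer_disjoint.
- exact: normalized_K.
- exact: normalized_K.
- exact: normalized_neq0 yN.
Qed.

Lemma baer_pair_E x : x \in baer_pair -> forall j, x 0 j \in E.
Proof.
case/baer_pairP => [xN j|[y yN ->] j]; first by rewrite K_sub_E ?normalized_K.
have -> : (y *m baer_mx) 0 j = (y *m col j baer_mx) 0 0.
  by rewrite colE mulmxA -colE [RHS]mxE.
apply: form_in_E => i; first by rewrite K_sub_E ?normalized_K.
by rewrite mxE baer_mx_E.
Qed.

(** Needed for the minimality of 1. All vectors of [baer_pair] have coordinates in E, so their
    multiples with first coordinate 1 do too; (1, t, 0) with [t] outside E is not one of them. *)
Lemma baer_pair_misses :
  exists2 v : 'rV[F]_3, v != 0 & forall x, x \in baer_pair -> v \notin <[x]>%VS.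
Proof.
have /subsetPn[t _ tE] : ~~ ([set: F] \subset E).
  apply/negP => /subset_leq_card; rewrite cardsT cardF card_E leq_exp2l //.
exists (row3 1 t 0) => [|x xB].
  by apply/eqP => /matrixP/(_ 0 0)/eqP; rewrite row3E mxE oner_eq0.
apply: contra tE => /vlineP[a /matrixP/(_ 0) eq_v].
have := eq_v 0; have := eq_v 1; rewrite !row3E !mxE => -> ax0.
have x0_neq0 : x 0 0 != 0.
  by apply/eqP => x0; move/eqP: ax0; rewrite x0 mulr0 oner_eq0.
have -> : a = (x 0 0)^-1 by apply: (mulIf x0_neq0); rewrite -ax0 mulVf.
by rewrite frob_fixedM ?frob_fixedV ?baer_pair_E.
Qed.

Lemma baer_pair_saturating :
  exists2 S : {fset pg_point 2 F},
    saturating 1 S & #|` S|%fset = (2 * d ^ 2 + 2 * d + 2)%N.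
Proof.
exists [fset proj_point x | x in baer_pair]%fset; last first.
  rewrite card_in_imfset /= => [|x y xB yB eq_xy]; first by rewrite -cardE card_baer_pair.
  have : x \in pg_space (proj_point y).
    by rewrite -eq_xy proj_pointE ?memv_line ?baer_pair_neq0.
  rewrite proj_pointE ?baer_pair_neq0 // => /vlineP[a].
  exact: baer_pair_scale.
split=> [P | r].
  have [v v_neq0 ->] := pg_pointP P.
  have [x [y [xB yB v_in]]] := baer_pair_covers v.
  exists [tuple proj_point x; proj_point y].
    by move=> Q; rewrite !inE => /orP[] /eqP ->; apply: in_imfset.
  by rewrite big_cons big_seq1 -memvE !proj_pointE ?baer_pair_neq0.
rewrite ltnS leqn0 => /eqP -> cov.
have [v v_neq0 v_notin] := baer_pair_misses.
(* For [r = 0] the tuple is a single point [Q] of the set, which would have to contain [v]. *)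
have [[[|Q [|]] //= sz] QS] := cov (proj_point v).
rewrite big_seq1 proj_pointE // -memvE.
have /imfsetP[x /= xB ->] := QS Q (mem_head _ _).
by rewrite proj_pointE ?baer_pair_neq0 // (negPf (v_notin _ xB)).
Qed.

End BaerPair.

Theorem theorem3 (p k q' q : nat) (p_prime : prime p) (k_gt0 : 0 < k)
    (q'E : q' = p ^ k) (qE : q = q' ^ 4)
    (F : finFieldType) (cardF : #|F| = q) :
  exists2 S : {fset pg_point 2 F},
    saturating 1 S & #|` S|%fset = 2 * q' ^ 2 + 2 * q' + 2.
Proof.
have pd : p.-nat q' by rewrite q'E pnatX pnat_id.
have q'_gt1 : 1 < q' by rewrite q'E -(exp1n k) ltn_exp2r // prime_gt1.
have cardF4 : #|F| = q' ^ 4 by rewrite cardF.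
have pcharFp : p \in [pchar F]%R.
  by apply: (card_finPcharP (n := k * 4)) => //; rewrite cardF4 q'E expnM.
have [c cK c_noroot] := cubic_without_root F (ltnW q'_gt1).
have /subsetPn[w wE wK] : ~~ (frob_fixed F (q' ^ 2) \subset frob_fixed F q').
  apply/negP => /subset_leq_card.
  by rewrite (card_E pcharFp pd) // (card_K pcharFp pd) // -{2}[q']expn1 leq_exp2l.
exact: (baer_pair_saturating pcharFp pd q'_gt1 cardF4 wE wK cK c_noroot).
Qed.
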